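(* Let $0<\alpha<1$ and $0<\beta<1-\alpha$. There exists a constant $c_0(\alpha,\beta)>0$ such that the minimax type II error rate satisfies $R_n(cn^{-1})\ge\beta$ for all $n$ and all $c\in(0,c_0(\alpha,\beta))$.
   Context: Fix $\sigma^2>0$, $K(\mathbf x,\mathbf y)=\exp\{-\sigma^2\|\mathbf x-\mathbf y\|^2/2\}$ on $\mathbb R^d$, $d=d_X+d_Y+d_Z$. For a distribution $\mathrm P$ of $(\mathbf X,\mathbf Y,\mathbf Z)$ on $\mathbb R^d$, let $\mathbf V_i=(\mathbf X_i,\mathbf Y_i,\mathbf Z_i)$ be i.i.d. from $\mathrm P$ and, given these, draw $\mathbf X_i'\sim\mathrm P_{\mathbf X\mid\mathbf Z_i}$ independently (so $\mathbf X_i'$ is conditionally independent of $(\mathbf X_i,\mathbf Y_i)$ given $\mathbf Z_i$); $\mathbf V_i'=(\mathbf X_i',\mathbf Y_i,\mathbf Z_i)$. Put $\zeta_\sigma(\mathrm P)=\mathbb E[K(\mathbf V_1,\mathbf V_2)]+\mathbb E[K(\mathbf V_1',\mathbf V_2')]-2\mathbb E[K(\mathbf V_1,\mathbf V_2')]$, which is $0$ iff $\mathbf X$ and $\mathbf Y$ are conditionally independent given $\mathbf Z$. Consider testing $H_0:\zeta_\sigma(\mathrm P)=0$ against $H_1':\zeta_\sigma(\mathrm P)>\epsilon(n)$. Let $\mathcal F(\epsilon)=\{\mathrm P:\zeta_\sigma(\mathrm P)>\epsilon\}$, let $\mathbb T_n(\alpha)$ be the class of all nonrandomized level-$\alpha$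 tests of $H_0$ based on the augmented data $\{(\mathbf X_i,\mathbf X_i',\mathbf Y_i,\mathbf Z_i)\}_{i=1}^n$ ($\phi=1$ means rejection), and define $$R_n(\epsilon)=\inf_{\phi\in\mathbb T_n(\alpha)}\ \sup_{F\in\mathcal F(\epsilon)}\mathbb P_{F^n}\{\phi=0\},$$ where $\mathbb P_{F^n}$ is the probability under the joint distribution of the augmented data when $(\mathbf X_i,\mathbf Y_i,\mathbf Z_i)$ are i.i.d. from $F$. *)

(* Defs.v *)
From HB Require Import structures.
From mathcomp Require Import all_boot all_order all_algebra.
From mathcomp Require Import all_classical all_reals all_analysis measurable_realfun.

Set Implicit Arguments.
Unset Strict Implicit.
Unset Printing Implicit Defensive.

Import Order.TTheory GRing.Theory Num.Theory.
Import numFieldNormedType.Exports.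

Local Open Scope classical_set_scope.
Local Open Scope ring_scope.
Local Open Scope ereal_scope.

(* The n-fold product probability on n.-tuple T, whose sigma-algebra is the
   product one (generated by the coordinates). *)
Section iid.
Context d (T : measurableType d) (R : realType).

Definition tcons n (p : T * n.-tuple T) : n.+1.-tuple T :=
  [the n.+1.-tuple T of p.1 :: p.2].

Lemma measurable_tcons n : measurable_fun [set: T * n.-tuple T] (@tcons n).
Proof. exact: measurable_cons. Qed.

HB.instance Definition _ n :=
  isMeasurableFun.Build _ _ _ _ (@tcons n) (@measurable_tcons n).

Fixpoint iid (P : probability T R) (n : nat) : probability (n.-tuple T) R :=
  match n with
  | 0 => dirac [tuple]
  | m.+1 => distribution (P \x iid P m) (@tcons m)
  end.

End iid.

(* Augmented observations. [k] is a version of the conditional law of X given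
   Z; since X, Z will range over Euclidean spaces, such a version always exists
   and [aug_law P k] does not depend on its choice. *)
Section augmentation.
Context dx dy dz (X : measurableType dx) (Y : measurableType dy)
  (Z : measurableType dz) (R : realType).
Implicit Types (P : probability (X * Y * Z)%type R) (k : R.-pker Z ~> X).

Definition is_cond_law P k := forall (A : set X) (B : set Z),
  measurable A -> measurable B ->
  P [set v | A v.1.1 /\ B v.2] = \int[P]_(v in [set v | B v.2]) k v.2 A.

Section cond_kernel.
Variable k : R.-pker Z ~> X.

Definition cond_kernel (v : X * Y * Z) : {measure set X -> \bar R} := k v.2.

Let measurable_cond_kernel U : measurable U ->
  measurable_fun [set: X * Y * Z] (cond_kernel ^~ U).
Proof.
move=> mU; exact: (measurableT_comp (measurable_kernel k U mU)
  (@measurable_snd _ _ (X * Y)%type Z)).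
Qed.

HB.instance Definition _ :=
  isKernel.Build _ _ _ _ _ cond_kernel measurable_cond_kernel.

Let cond_kernelT v : cond_kernel v [set: X] = 1.
Proof. exact: prob_kernel. Qed.

HB.instance Definition _ :=
  Kernel_isProbability.Build _ _ _ _ _ cond_kernel cond_kernelT.

End cond_kernel.

(* The joint law of ((X, Y, Z), X') with (X, Y, Z) ~ P and
   X' | (X, Y, Z) ~ k Z. *)
Definition aug_law P k (A : set (X * Y * Z * X)) : \bar R :=
  \int[P]_v k v.2 (xsection A v).

Section aug_law_probability.
Variables (P : probability (X * Y * Z)%type R) (k : R.-pker Z ~> X).

Let aug_law0 : aug_law P k set0 = 0.
Proof. by apply: integral0_eq => v _; rewrite xsection0 measure0. Qed.

Let aug_law_ge0 A : 0 <= aug_law P k A.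
Proof. by apply: integral_ge0 => v _; exact: measure_ge0. Qed.

Let aug_law_sigma_additive : semi_sigma_additive (aug_law P k).
Proof.
move=> F mF tF mUF.
have mk n : measurable_fun [set: X * Y * Z]
    (fun v => k v.2 (xsection (F n) v)).
  by apply: (measurable_fun_xsection_finite_kernel (cond_kernel k));
    rewrite inE.
rewrite [X in _ --> X](_ : _ = \sum_(n <oo) aug_law P k (F n)).
  by apply: is_cvg_nneseries => n _ _; exact: aug_law_ge0.
rewrite /aug_law -integral_nneseries//.
apply: eq_integral => v _; rewrite xsection_bigcup; apply/esym.
apply: cvg_lim => //; apply: measure_sigma_additive.
  by move=> n; exact: measurable_xsection.
exact: trivIset_xsection.
Qed.

HB.instance Definition _ := isMeasure.Build _ _ _ (aug_law P k)
  aug_law0 aug_law_ge0 aug_law_sigma_additive.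

Let aug_lawT : aug_law P k [set: X * Y * Z * X] = 1.
Proof.
rewrite /aug_law -[RHS](probability_setT P) -[RHS]mul1e -integral_cst//.
apply: eq_integral => v _ /=.
rewrite (_ : xsection _ _ = setT) ?prob_kernel//.
by apply/seteqP; split=> // x _; rewrite /xsection/= inE.
Qed.

HB.instance Definition _ :=
  Measure_isProbability.Build _ _ _ (aug_law P k) aug_lawT.

End aug_law_probability.

Definition orig (w : X * Y * Z * X) : X * Y * Z := w.1.

Definition swapped (w : X * Y * Z * X) : X * Y * Z := (w.2, w.1.1.2, w.1.2).

End augmentation.

Section testing.
Variables (R : realType) (dX dY dZ : nat) (sigma : R).

(* R^d is d.-tuple R, with the product (that is, Borel) sigma-algebra. *)
Local Notation XT := (dX.-tuple R).
Local Notation YT := (dY.-tuple R).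
Local Notation ZT := (dZ.-tuple R).
Local Notation V := (XT * YT * ZT)%type.
Local Notation data := (V * XT)%type.

Definition sqdist n (u v : n.-tuple R) : R :=
  (\sum_(i < n) (tnth u i - tnth v i) ^+ 2)%R.

(* The squared Euclidean norm on R^(dX + dY + dZ) is the sum over the blocks. *)
Definition gauss (u v : V) : R :=
  expR (- (sigma ^+ 2 *
    (sqdist u.1.1 v.1.1 + sqdist u.1.2 v.1.2 + sqdist u.2 v.2) / 2)).

Definition zeta (P : probability V R) (k : R.-pker ZT ~> XT) : \bar R :=
  let Q : probability data R := aug_law P k in
  'E_(Q \x Q)[fun w => gauss (orig w.1) (orig w.2)]
  + 'E_(Q \x Q)[fun w => gauss (swapped w.1) (swapped w.2)]
  - 2%:E * 'E_(Q \x Q)[fun w => gauss (orig w.1) (swapped w.2)].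

(* Distributions are paired with a version of the law of X given Z. *)
Definition null : set (probability V R * (R.-pker ZT ~> XT)) :=
  [set F | is_cond_law F.1 F.2 /\ zeta F.1 F.2 = 0].

Definition alternatives (eps : R) :
  set (probability V R * (R.-pker ZT ~> XT)) :=
  [set F | is_cond_law F.1 F.2 /\ eps%:E < zeta F.1 F.2].

(* Nonrandomized tests; [true] means rejection. *)
Definition level_tests (n : nat) (alpha : R) : set (n.-tuple data -> bool) :=
  [set phi | measurable_fun [set: n.-tuple data] phi /\
    forall F, null F ->
      iid (aug_law F.1 F.2) n [set s | phi s = true] <= alpha%:E].
Arguments level_tests : clear implicits.

Definition minimax_type2 (n : nat) (alpha eps : R) : \bar R :=
  ereal_inf [set ereal_sup
      [set iid (aug_law F.1 F.2) n [set s | phi s = false]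
        | F in alternatives eps]
    | phi in level_tests n alpha].

End testing.

(* Main.v *)
Require Import Defs.
From mathcomp Require Import all_boot all_order all_algebra.
From mathcomp Require Import all_classical all_reals all_analysis measurable_realfun.
From HB Require Import structures.
From mathcomp Require Import ring lra.
Import Order.TTheory GRing.Theory Num.Theory.
Local Open Scope classical_set_scope.
Local Open Scope ring_scope.

(** Le Cam's two-point method, with a pair of four-point laws. Freeze Z at a
    single point and let X and Y take two values each, with probabilities
      P(X = x_b, Y = y_b') = (1 + delta) / 4  if b = b',
                             (1 - delta) / 4  otherwise.
    Both marginals are uniform whatever delta is, so X' is an independent fair
    choice between x_0 and x_1 and carries no information about delta. For
    delta = 0 the law is null, and the likelihood ratio of one augmented
    observation against it is 1 + delta or 1 - delta, each with probability 1/2.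

    Two facts, one quadratic in delta on each side, make this pair hard. The
    discrepancy zeta is the squared kernel norm of the signed measure
    (delta / 4) s(x) s(y), where s is the sign of the atom; spacing the atoms so
    that the kernel takes the value 1/2 between x_0 and x_1, and between y_0 and
    y_1, makes it equal to delta^2 / 16 whatever sigma and the dimensions are
    ([exists_hard_law]). This is why the final constant depends on neither.
    The chi-square divergence of the n-fold laws is (1 + delta^2)^n - 1, because
    second moments of likelihood ratios multiply over independent observations.
    Taking delta^2 = 32 c / n gives zeta = 2 c / n > c / n, and a divergence of
    at most exp(32 c) - 1, which is below eta^2, with eta = 1 - alpha - beta, as
    soon as c < ln (1 + eta^2) / 32. An event then changes probability by at
    most eta between the two laws ([expect_iid_change]), so that a test that
    accepts with probability at least 1 - alpha under the null law still accepts
    with probability at least beta under the alternative.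

    As all the laws are finitely supported, probabilities under the n-fold
    product are finite sums over n-tuples of atom indices ([iid_atoms]), and the
    change of measure is a computation with such sums. *)

(** * Product weights on tuples *)

Lemma sum_tuple_cons (V : nmodType) (J : finType) n (F : n.+1.-tuple J -> V) :
  \sum_t F t = \sum_j \sum_(t : n.-tuple J) F [tuple of j :: t].
Proof.
rewrite pair_bigA/= (reindex (fun p : J * n.-tuple J => [tuple of p.1 :: p.2]))//=.
exists (fun t => (thead t, [tuple of behead t])) => [[j t] _|t _] /=.
  by congr pair; exact/val_inj.
by rewrite [RHS]tuple_eta; exact/val_inj.
Qed.

Definition expect_iid {R : realType} {J : finType} (p : J -> R) n
    (f : n.-tuple J -> R) : R :=
  \sum_(t : n.-tuple J) (\prod_(j <- t) p j) * f t.

Lemma expect_iid_prod {R : realType} {J : finType} (p g : J -> R) n :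
  expect_iid p n (fun t => \prod_(j <- t) g j) = (\sum_j p j * g j) ^+ n.
Proof.
rewrite /expect_iid; under eq_bigr do rewrite -big_split/=.
elim: n => [|n IH].
  rewrite (big_pred1 [tuple]) ?big_nil// => t.
  by apply/esym/eqP; exact: tuple0.
rewrite sum_tuple_cons exprS -IH mulr_suml; apply: eq_bigr => j _.
by rewrite mulr_sumr; apply: eq_bigr => t _; rewrite big_cons.
Qed.

(** The change of measure behind Le Cam's method: [l] is the likelihood ratio of
    one observation and [m] its second moment, so [m ^+ n - 1] is the chi-square
    divergence of the product laws. Integrating the pointwise bound
    [|1 - L| <= ((L - 1) ^+ 2 / eta + eta) / 2] yields
    [((m ^+ n - 1) / eta + eta) / 2 <= eta], the same bound as Cauchy-Schwarz
    would give. *)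
Lemma expect_iid_change {R : realType} {J : finType} (p l : J -> R) n
    (f : n.-tuple J -> R) (m eta : R) :
  (forall j, 0 <= p j) -> \sum_j p j = 1 -> \sum_j p j * l j = 1 ->
  \sum_j p j * l j ^+ 2 = m -> 0 < eta -> m ^+ n <= 1 + eta ^+ 2 ->
  (forall t, 0 <= f t <= 1) ->
  expect_iid p n f <= expect_iid (fun j => p j * l j) n f + eta.
Proof.
move=> p0 p1 pl1 pl2 eta0 hm f01.
pose L (t : n.-tuple J) := \prod_(j <- t) l j.
have E1 : \sum_(t : n.-tuple J) (\prod_(j <- t) p j) = 1.
  have := expect_iid_prod p (fun=> 1) n; rewrite /expect_iid.
  under eq_bigr do rewrite big1_eq mulr1.
  by under [X in _ = X ^+ _]eq_bigr do rewrite mulr1; rewrite p1 expr1n.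
have EL : expect_iid p n L = 1 by rewrite expect_iid_prod pl1 expr1n.
have EL2 : \sum_(t : n.-tuple J) (\prod_(j <- t) p j) * L t ^+ 2 = m ^+ n.
  rewrite -pl2 -expect_iid_prod; apply: eq_bigr => t _.
  by rewrite /L -prodrXl.
have -> : expect_iid (fun j => p j * l j) n f =
          \sum_(t : n.-tuple J) (\prod_(j <- t) p j) * (L t * f t).
  by apply: eq_bigr => t _; rewrite big_split/= mulrA.
(* [G t - L t * f t] is [((L t - 1) ^+ 2 / eta + eta) / 2], hence bounds both
   [1 - L t] and [L t - 1]: the two differences are squares times [eta / 2]. *)
pose G t := L t * f t + (L t ^+ 2 / (2 * eta) - L t / eta + (eta^-1 + eta) / 2).
have fG t : f t <= G t.
  have /andP[f0 f1] := f01 t; rewrite /G.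
  have : 0 <= ((L t - 1) / eta - 1) ^+ 2 * eta / 2.
    by rewrite divr_ge0// mulr_ge0// ?sqr_ge0// ltW.
  have : 0 <= ((L t - 1) / eta + 1) ^+ 2 * eta / 2.
    by rewrite divr_ge0// mulr_ge0// ?sqr_ge0// ltW.
  rewrite (_ : ((L t - 1) / eta + 1) ^+ 2 * eta / 2 =
    L t ^+ 2 / (2 * eta) - L t / eta + (eta^-1 + eta) / 2 + (L t - 1)).
    2: by field; rewrite gt_eqF.
  rewrite (_ : ((L t - 1) / eta - 1) ^+ 2 * eta / 2 =
    L t ^+ 2 / (2 * eta) - L t / eta + (eta^-1 + eta) / 2 - (L t - 1)).
    2: by field; rewrite gt_eqF.
  move: (_ + _ / 2) => A; nra.
apply: (@le_trans _ _ (\sum_(t : n.-tuple J) (\prod_(j <- t) p j) * G t)).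
  by apply: ler_sum => t _; apply: ler_wpM2l => //; exact: prodr_ge0.
rewrite (eq_bigr (fun t : n.-tuple J => (\prod_(j <- t) p j) * (L t * f t)
   + ((\prod_(j <- t) p j) * L t ^+ 2 * (2 * eta)^-1
    + ((\prod_(j <- t) p j) * L t * (- eta^-1)
    + (\prod_(j <- t) p j) * ((eta^-1 + eta) / 2))))); last first.
  by move=> t _; rewrite /G; ring.
rewrite !big_split/= lerD2l -!mulr_suml EL2 E1.
rewrite -[X in _ + (X * _ + _)]/(expect_iid p n L) EL.
have -> : m ^+ n / (2 * eta) + (1 * - eta^-1 + 1 * ((eta^-1 + eta) / 2)) =
  (m ^+ n - 1 + eta ^+ 2) / (2 * eta) by field; rewrite gt_eqF.
rewrite ler_pdivrMr ?mulr_gt0//; lra.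
Qed.

(** * Finitely supported measures *)

(** Stated on measurable sets only, so that it can hold of a measure that is
    built otherwise, such as [aug_law P k] or [iid P n], in a space where
    singletons need not be measurable. *)
Definition has_atoms {d} {T : measurableType d} {R : realType} {J : finType}
    (P : set T -> \bar R) (p : J -> R) (a : J -> T) :=
  forall A, measurable A -> P A = (\sum_j p j * \1_A (a j))%:E.

Section atoms.
Context {d} {T : measurableType d} {R : realType} {J : finType}.
Variables (p : J -> R) (a : J -> T) (p0 : forall j, 0 <= p j).

Definition atomic_measure : {measure set T -> \bar R} :=
  msum (fun i => match insub i : option 'I_#|J| with
                 | Some o => let j := @enum_val J J o in
                             mscale (NngNum (p0 j)) (dirac (a j))
                 | None => mzero end) #|J|.

Lemma atomic_measureE : has_atoms atomic_measure p a.
Proof.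
move=> A mA; rewrite /= /msum -sumEFin (reindex (@enum_val J J))/=; last first.
  by apply: onW_bij; exact: enum_val_bij.
by apply: eq_bigr => i _; rewrite valK/= /mscale/= diracE EFinM.
Qed.

Lemma ge0_integral_atoms (P : {measure set T -> \bar R}) (f : T -> R) :
  has_atoms P p a -> (forall x, 0 <= f x) -> measurable_fun setT f ->
  (\int[P]_x (f x)%:E)%E = (\sum_j p j * f (a j))%:E.
Proof.
move=> Pa f0 mf.
rewrite (@eq_measure_integral _ _ _ _ atomic_measure); last first.
  by move=> A mA _; rewrite Pa// atomic_measureE.
have mEf : measurable_fun setT (EFin \o f) by exact/measurable_EFinP.
rewrite ge0_integral_measure_sum//; last by move=> x _; rewrite lee_fin.
rewrite -sumEFin [RHS](reindex (@enum_val J J))/=; last first.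
  by apply: onW_bij; exact: enum_val_bij.
apply: eq_bigr => i _; rewrite valK/= ge0_integral_mscale//; last first.
  by move=> x _; rewrite lee_fin.
by rewrite integral_dirac//= diracT mul1e EFinM.
Qed.

Variable p1 : \sum_j p j = 1.

(** A copy of [atomic_measure] that can carry the probability structure. *)
Definition atomic : set T -> \bar R := atomic_measure.
HB.instance Definition _ := Measure.on atomic.
Let atomicT : atomic setT = 1%E.
Proof.
rewrite /atomic atomic_measureE//.
by under eq_bigr do rewrite indicT mulr1; rewrite p1.
Qed.
HB.instance Definition _ := Measure_isProbability.Build _ _ _ atomic atomicT.

Lemma exists_atomic_probability : exists P : probability T R, has_atoms P p a.
Proof. by exists atomic; exact: atomic_measureE. Qed.

End atoms.

Lemma integral_prod_atoms {d1 d2} {T1 : measurableType d1} {T2 : measurableType d2}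
    {R : realType} {J : finType} (p q : J -> R) (a : J -> T1) (b : J -> T2)
    (P : probability T1 R) (Q : probability T2 R) (f : T1 * T2 -> R) :
  (forall j, 0 <= p j) -> (forall j, 0 <= q j) ->
  has_atoms P p a -> has_atoms Q q b ->
  (forall x, 0 <= f x) -> measurable_fun setT f ->
  (\int[P \x Q]_x (f x)%:E)%E = (\sum_i \sum_j p i * q j * f (a i, b j))%:E.
Proof.
move=> p0 q0 Pa Qb f0 mf.
have mEf : measurable_fun setT (EFin \o f) by exact/measurable_EFinP.
rewrite (@fubini_tonelli1 _ _ _ _ _ P Q (EFin \o f))//=.
have mf1 x : measurable_fun setT (fun y => f (x, y)).
  by apply: measurableT_comp => //; exact: measurable_pair1.
rewrite /fubini_F.
under eq_integral do rewrite (ge0_integral_atoms _ _ q0 _ _ Qb)//.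
rewrite (ge0_integral_atoms _ _ p0 _ _ Pa)/=.
- congr EFin; apply: eq_bigr => i _; rewrite mulr_sumr.
  by apply: eq_bigr => j _; rewrite mulrA.
- by move=> x; apply: sumr_ge0 => j _; exact: mulr_ge0.
- apply: measurable_sum => j; apply: measurable_funM => //.
  by apply: measurableT_comp => //; exact: measurable_pair2.
Qed.

(** Reduces every probability under the n-fold product to a finite sum over the
    tuples of atom indices, so that the change of measure can be carried out on
    indices, without decoding the observed points. *)
Lemma iid_atoms {d} {T : measurableType d} {R : realType} {J : finType}
    (p : J -> R) (a : J -> T) (P : probability T R) n :
  (forall j, 0 <= p j) -> has_atoms P p a ->
  has_atoms (iid P n) (fun t : n.-tuple J => \prod_(j <- t) p j) (map_tuple a).
Proof.
move=> p0 Pa; elim: n => [|n IH] A mA.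
  rewrite (big_pred1 [tuple])/=.
    rewrite big_nil mul1r diracE; congr (\1_A _)%:E; exact: val_inj.
  by move=> t; apply/esym/eqP; exact: tuple0.
have mB : measurable (@tcons _ T n @^-1` A).
  by rewrite -[X in measurable X]setTI; exact: measurable_tcons.
rewrite /= /distribution /pushforward /= /product_measure1.
under eq_integral => x _.
  rewrite /= IH; last exact: measurable_xsection.
  over.
rewrite (ge0_integral_atoms _ _ p0 _ _ Pa).
- rewrite sum_tuple_cons; congr EFin; apply: eq_bigr => j _; rewrite mulr_sumr.
  apply: eq_bigr => t _; rewrite big_cons mulrA; congr (_ * _).
  rewrite !indicE mem_xsection.
  have <- : tcons (a j, map_tuple a t) = map_tuple a [tuple of j :: t].
    exact: val_inj.
  by congr (nat_of_bool _)%:R; apply/idP/idP; rewrite !in_setE.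
- move=> x; apply: sumr_ge0 => t _; rewrite mulr_ge0//; exact: prodr_ge0.
- apply: measurable_sum => t; apply: measurable_funM => //.
  under eq_fun do rewrite indicE mem_xsection -indicE.
  apply: (measurableT_comp (measurable_indic mB)).
  exact: measurable_pair2.
Qed.

(** * Augmentation when the conditional law of X is constant *)

Lemma exists_constant_kernel {d d'} {Z : measurableType d} {X : measurableType d'}
    {R : realType} (P : probability X R) :
  exists k : R.-pker Z ~> X, forall z, k z = P.
Proof.
pose c : Z -> pprobability X R := fun=> P.
have mc : measurable_fun setT c by exact: measurable_cst.
by exists (kprobability mc).
Qed.

Section constant_kernel.
Context {dx dy dz} {X : measurableType dx} {Y : measurableType dy}
  {Z : measurableType dz} {R : realType} {I J : finType}.
Variables (p : I -> R) (a : I -> X * Y * Z) (q : J -> R) (b : J -> X).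
Variables (P : probability (X * Y * Z)%type R) (k : R.-pker Z ~> X).
Hypotheses (p0 : forall i, 0 <= p i) (q0 : forall j, 0 <= q j).
Hypotheses (Pa : has_atoms P p a) (kb : forall z, has_atoms (k z) q b).

Lemma aug_law_atoms : has_atoms (aug_law P k)
  (fun ij : I * J => p ij.1 * q ij.2) (fun ij => (a ij.1, b ij.2)).
Proof.
move=> A mA; rewrite /= /aug_law.
under eq_integral => v _.
  rewrite kb; last exact: measurable_xsection.
  over.
rewrite (ge0_integral_atoms _ _ p0 _ _ Pa).
- rewrite -(pair_bigA _ (fun i j => p i * q j * \1_A (a i, b j)))/=.
  congr EFin; apply: eq_bigr => i _; rewrite mulr_sumr; apply: eq_bigr => j _.
  by rewrite mulrA !indicE mem_xsection.
- by move=> x; apply: sumr_ge0 => t _; rewrite mulr_ge0.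
- apply: measurable_sum => t; apply: measurable_funM => //.
  under eq_fun do rewrite indicE mem_xsection -indicE.
  apply: (measurableT_comp (measurable_indic mA)).
  exact: measurable_pair2.
Qed.

End constant_kernel.

(** * The Gaussian kernel *)

Lemma measurable_gauss {d} {T : measurableType d} {R : realType} {dX dY dZ : nat}
    (sigma : R) (f g : T -> dX.-tuple R * dY.-tuple R * dZ.-tuple R) :
  measurable_fun setT f -> measurable_fun setT g ->
  measurable_fun setT (fun w => gauss sigma (f w) (g w)).
Proof.
move=> mf mg.
have msq n (u v : T -> n.-tuple R) : measurable_fun setT u ->
    measurable_fun setT v -> measurable_fun setT (fun w => sqdist (u w) (v w)).
  move=> mu mv; apply: measurable_sum => i; apply: measurable_funX.
  by apply: measurable_funB; apply: (measurableT_comp (measurable_tnth i)).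
have fst_ d1 d2 (A : measurableType d1) (B : measurableType d2) (h : T -> A * B) :
  measurable_fun setT h -> measurable_fun setT (fst \o h).
  by move=> mh; apply: (measurableT_comp measurable_fst).
have snd_ d1 d2 (A : measurableType d1) (B : measurableType d2) (h : T -> A * B) :
  measurable_fun setT h -> measurable_fun setT (snd \o h).
  by move=> mh; apply: (measurableT_comp measurable_snd).
apply: measurableT_comp => //; apply: measurableT_comp => //.
apply: measurable_funM => //; apply: measurable_funM => //.
apply: measurable_funD; first apply: measurable_funD.
- by apply: msq; [exact/fst_/fst_|exact/fst_/fst_].
- by apply: msq; [exact/snd_/fst_|exact/snd_/fst_].
- by apply: msq; [exact/snd_|exact/snd_].
Qed.

(** Since the bandwidth is fixed, the atoms are spaced according to it. This is
    what makes the discrepancy of the hard law free of [sigma] and [d]. *)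
Lemma exists_half_kernel_pair {R : realType} {d : nat} {sigma : R} :
  (0 < d)%N -> 0 < sigma ^+ 2 ->
  exists u : bool -> d.-tuple R, forall b b',
    expR (- (sigma ^+ 2 * sqdist (u b) (u b') / 2)) = if b == b' then 1 else 1 / 2.
Proof.
move=> d0 s0.
have M0 : 0 <= 2 * ln 2 / (d%:R * sigma ^+ 2) :> R.
  by rewrite divr_ge0// mulr_ge0 ?ln_ge0 ?ler1n// ltW.
(* All [d] coordinates move by the same amount, so that the squared distance is
   [2 * ln 2 / sigma ^+ 2]. *)
exists (fun b => [tuple b%:R * Num.sqrt (2 * ln 2 / (d%:R * sigma ^+ 2)) | i < d]).
move=> b b'; rewrite /sqdist; under eq_bigr do
  rewrite !tnth_mktuple -mulrBl exprMn sqr_sqrtr//.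
rewrite sumr_const card_ord -[_ *+ d]mulr_natr.
have E : b != b' -> ((b%:R - b'%:R) ^+ 2 = 1 :> R).
  by case: b b' => [] []//= _; ring.
have [->|/E ->] := eqVneq b b'.
  by rewrite subrr expr0n/= !(mul0r, mulr0) oppr0 expR0.
rewrite (_ : - _ = - ln 2); first by rewrite expRN lnK ?posrE// mul1r.
field; rewrite pnatr_eq0 -lt0n d0 andbT; move: s0; rewrite expr2.
by apply: contraTneq => ->; rewrite mul0r ltxx.
Qed.

(** * The hard law *)

Lemma sum_bool3 {V : nmodType} (F : bool * bool * bool -> V) :
  \sum_j F j = \sum_b1 \sum_b2 \sum_b3 F (b1, b2, b3).
Proof.
rewrite (pair_bigA _ (fun b1 b2 => \sum_b3 F (b1, b2, b3)))/=.
by rewrite (pair_bigA _ (fun j b3 => F (j.1, j.2, b3)))/=; apply: eq_bigr => -[[]].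
Qed.

Lemma sum_bool2 {V : nmodType} (F : bool * bool -> V) :
  \sum_j F j = \sum_b1 \sum_b2 F (b1, b2).
Proof.
by rewrite (pair_bigA _ (fun b1 b2 => F (b1, b2)))/=; apply: eq_bigr => -[].
Qed.

(** Against the law with [delta = 0]. *)
Definition likelihood_ratio {R : realType} (delta : R) (b1 b2 : bool) : R :=
  1 + (if b1 == b2 then delta else - delta).

(** The atoms are indexed by the values chosen for X, Y and X', in this order.
    They are the same for every [delta], which lets the laws of different
    [delta] be compared through their weights alone. *)
Lemma exists_hard_law {R : realType} {dX dY dZ : nat} (sigma : R) :
  (0 < dX)%N -> (0 < dY)%N -> 0 < sigma ^+ 2 ->
  exists a : bool * bool * bool ->
      dX.-tuple R * dY.-tuple R * dZ.-tuple R * dX.-tuple R,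
  forall delta, 0 <= delta <= 1 ->
  exists P : probability (dX.-tuple R * dY.-tuple R * dZ.-tuple R)%type R,
  exists k : R.-pker (dZ.-tuple R) ~> (dX.-tuple R),
  [/\ is_cond_law P k, zeta sigma P k = (delta ^+ 2 / 16)%:E &
      has_atoms (aug_law P k)
        (fun j => 1 / 8 * likelihood_ratio delta j.1.1 j.1.2) a].
Proof.
move=> dX0 dY0 s0.
have [ux uxE] := exists_half_kernel_pair dX0 s0.
have [uy uyE] := exists_half_kernel_pair dY0 s0.
pose z0 : dZ.-tuple R := [tuple 0 | i < dZ].
pose a (j : bool * bool) := (ux j.1, uy j.2, z0).
exists (fun j => (a j.1, ux j.2)) => delta /andP[d0 d1].
pose p (j : bool * bool) := 1 / 4 * likelihood_ratio delta j.1 j.2.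
have p0 j : 0 <= p j.
  by rewrite mulr_ge0 ?divr_ge0// /likelihood_ratio; case: ifP => _; lra.
have h0 (b : bool) : 0 <= 1 / 2 :> R by rewrite divr_ge0.
have [P Pa] : exists P : probability _ R, has_atoms P p a.
  apply: exists_atomic_probability => //.
  by rewrite sum_bool2 !big_bool /p/likelihood_ratio/=; field.
have [X Xu] : exists P : probability _ R, has_atoms P (fun=> 1 / 2) ux.
  by apply: exists_atomic_probability => //; rewrite big_bool/=; field.
have [k kE] := @exists_constant_kernel _ _ (dZ.-tuple R) _ _ X.
have ku z : has_atoms (k z) (fun=> 1 / 2) ux by rewrite kE.
have Qa := aug_law_atoms _ _ _ _ _ _ p0 h0 Pa ku.
pose V := (dX.-tuple R * dY.-tuple R * dZ.-tuple R)%type.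
exists P, k; split.
- move=> A B mA mB.
  have mBv : measurable [set v : V | B v.2].
    by rewrite -[X in measurable X]setTI; exact: measurable_snd.
  have mAv : measurable [set v : V | A v.1.1].
    rewrite -[X in measurable X]setTI.
    exact: (measurableT_comp measurable_fst measurable_fst).
  under eq_integral do rewrite ku//.
  rewrite integral_cst//= !Pa//; last exact: measurableI.
  rewrite -EFinM big_bool !sum_bool2 !big_bool /p /likelihood_ratio/=.
  have E j : \1_[set v : V | A v.1.1 /\ B v.2] (a j) =
      \1_A (ux j.1) * \1_B z0 :> R.
    rewrite !indicE -natrM mulnb; congr (nat_of_bool _)%:R.
    by apply/idP/andP; rewrite !in_setE.
  have F j : \1_[set v : V | B v.2] (a j) = \1_B z0 :> R.
    by rewrite !indicE; congr (nat_of_bool _)%:R; apply/idP/idP; rewrite !in_setE.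
  by rewrite !E !F /=; congr EFin; field.
- pose K (b b' : bool) : R := if b == b' then 1 else 1 / 2.
  have gE b1 b2 b1' b2' : gauss sigma (ux b1, uy b2, z0) (ux b1', uy b2', z0) =
      K b1 b1' * K b2 b2'.
    rewrite /K -uxE -uyE -expRD /gauss/= (_ : sqdist z0 z0 = 0).
      by congr expR; field.
    by rewrite /sqdist big1// => i _; rewrite subrr expr0n.
  have morig : measurable_fun setT
      (@orig _ _ _ (dX.-tuple R) (dY.-tuple R) (dZ.-tuple R)).
    exact: measurable_fst.
  have mswap : measurable_fun setT
      (@swapped _ _ _ (dX.-tuple R) (dY.-tuple R) (dZ.-tuple R)).
    apply: measurable_fun_pair; first apply: measurable_fun_pair.
    + exact: measurable_snd.
    + apply: (measurableT_comp measurable_snd).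
      exact: (measurableT_comp measurable_fst measurable_fst).
    + exact: (measurableT_comp measurable_snd measurable_fst).
  have q0 (j : bool * bool * bool) : 0 <= p j.1 * (1 / 2) by rewrite mulr_ge0// divr_ge0.
  (* [f'] and [g'] pick, from the index of an augmented atom, that of the point
     of [V] compared by the kernel. *)
  have EE (f g : V * dX.-tuple R -> V)
      (f' g' : bool * bool * bool -> bool * bool) :
      measurable_fun setT f -> measurable_fun setT g ->
      (forall j, f (a j.1, ux j.2) = a (f' j)) ->
      (forall j, g (a j.1, ux j.2) = a (g' j)) ->
      ('E_(aug_law P k \x aug_law P k)[fun w => gauss sigma (f w.1) (g w.2)])%E =
      (\sum_i \sum_j p i.1 * (1 / 2) * (p j.1 * (1 / 2)) *
        (K (f' i).1 (g' j).1 * K (f' i).2 (g' j).2))%:E.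
    move=> mf mg fE gE'.
    rewrite unlock (integral_prod_atoms _ _ _ _ _ _ _ q0 q0 Qa Qa)//.
    - by congr EFin; apply: eq_bigr => i _; apply: eq_bigr => j _; rewrite fE gE' gE.
    - by move=> x; exact: expR_ge0.
    - apply: measurable_gauss.
        exact: (measurableT_comp mf measurable_fst).
      exact: (measurableT_comp mg measurable_snd).
  (* Swapping X for X' sends the atom of index (b1, b2, b3) to (b3, b2). *)
  pose s (j : bool * bool * bool) := (j.2, j.1.2).
  rewrite /zeta (EE _ _ fst fst)// (EE _ _ s s)// (EE _ _ fst s)//.
  rewrite -EFinM -EFinD; congr EFin.
  rewrite !sum_bool3 !big_bool /= !sum_bool3 !big_bool /= /K /p /likelihood_ratio /=.
  by field.
- move=> A mA; rewrite Qa//; congr EFin; apply: eq_bigr => j _.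
  by rewrite /p; congr (_ * _); field.
Qed.

(** * The minimax lower bound *)

Theorem theorem3p3 (R : realType) (alpha beta : R)
    (halpha : 0 < alpha < 1) (hbeta : 0 < beta < 1 - alpha) :
  exists2 c0 : R, 0 < c0 &
    forall (dX dY dZ : nat) (sigma : R),
      (0 < dX)%N -> (0 < dY)%N -> (0 < dZ)%N -> 0 < sigma ^+ 2 ->
    forall (n : nat) (c : R), (0 < n)%N -> 0 < c < c0 ->
      (beta%:E <= minimax_type2 dX dY dZ sigma n alpha (c / n%:R))%E.
Proof.
have /andP[a0 a1] := halpha; have /andP[b0 b1] := hbeta.
pose eta := 1 - alpha - beta.
have eta0 : 0 < eta by rewrite /eta; lra.
have eta1 : eta <= 1 by rewrite /eta; lra.
have eta2 : 0 < eta ^+ 2 by rewrite exprn_gt0.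
(* [eta ^+ 2] is the chi-square budget; 32 is twice the 16 of [zeta], the factor
   2 making the alternative strict. *)
exists (ln (1 + eta ^+ 2) / 32); first by rewrite divr_gt0// ln_gt0// ltrDl.
move=> dX dY dZ sigma dX0 dY0 _ s0 n c n0 /andP[c_gt0].
rewrite ltr_pdivlMr// => cc0.
have n0' : 0 < n%:R :> R by rewrite ltr0n.
(* Ensures [delta <= 1], that is, nonnegative weights. *)
have c1 : c * 32 <= 1.
  have lnle : ln (1 + eta ^+ 2) <= eta ^+ 2 by apply: le_ln1Dx; lra.
  by rewrite (le_trans (ltW cc0))// (le_trans lnle)// expr_le1// ltW.
pose delta := Num.sqrt (c * 32 / n%:R).
have d2 : delta ^+ 2 = c * 32 / n%:R.
  by rewrite sqr_sqrtr// divr_ge0// mulr_ge0// ltW.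
have d01 : 0 <= delta <= 1.
  rewrite sqrtr_ge0/= -(@ler_pXn2r _ 2)// ?nnegrE ?sqrtr_ge0// d2 expr1n.
  by rewrite ler_pdivrMr// mul1r (le_trans c1)// ler1n.
have [a aP] := @exists_hard_law R dX dY dZ sigma dX0 dY0 s0.
have [|P0 [k0 [cond0 zeta0 Q0]]] := aP 0; first by rewrite lexx ler01.
have [P1 [k1 [cond1 zeta1 Q1]]] := aP delta d01.
apply/ereal_infP => _ [phi [mphi level] <-].
apply: le_ereal_sup_tmp.
exists (iid (aug_law P1 k1) n [set s | phi s = false]).
  exists (P1, k1) => //; split => //=.
  rewrite zeta1 lte_fin d2 ltr_pdivrMr//.
  have -> : c * 32 / n%:R / 16 * n%:R = c * 2 by field; rewrite gt_eqF.
  by lra.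
have /level : null sigma (P0, k0).
  by split => //=; rewrite zeta0 expr0n mul0r.
have mT b : measurable [set s | phi s = b].
  by have := mphi measurableT [set b] I; rewrite setTI.
have l1 (j : bool * bool * bool) : 0 <= 1 / 8 * likelihood_ratio 0 j.1.1 j.1.2 :> R.
  by rewrite /likelihood_ratio oppr0 if_same addr0 mulr1 divr_ge0.
have l2 (j : bool * bool * bool) : 0 <= 1 / 8 * likelihood_ratio delta j.1.1 j.1.2 :> R.
  by rewrite mulr_ge0 ?divr_ge0// /likelihood_ratio; case: ifP => _; move: d01; lra.
have -> : [set s | phi s = true] = ~` [set s | phi s = false].
  by apply/seteqP; split => t /=; case: (phi t).
rewrite probability_setC// (iid_atoms _ _ _ n l1 Q0)// (iid_atoms _ _ _ n l2 Q1)//.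
rewrite !lee_fin => lev.
pose p (j : bool * bool * bool) : R := 1 / 8.
pose l (j : bool * bool * bool) : R := likelihood_ratio delta j.1.1 j.1.2.
pose f (t : n.-tuple (bool * bool * bool)) : R :=
  \1_[set s | phi s = false] (map_tuple a t).
have : expect_iid p n f <= expect_iid (fun j => p j * l j) n f + eta.
  apply: (@expect_iid_change _ _ p l n f (1 + delta ^+ 2)) => //.
  - by move=> j; rewrite /p divr_ge0.
  - by rewrite sum_bool3 !big_bool /p/=; field.
  - by rewrite sum_bool3 !big_bool /p/l/likelihood_ratio/=; field.
  - by rewrite sum_bool3 !big_bool /p/l/likelihood_ratio/=; field.
  - apply: (@le_trans _ _ (expR (delta ^+ 2) ^+ n)).
      by rewrite lerXn2r ?nnegrE ?expR_ge0 ?expR_ge1Dx// addr_ge0// sqr_ge0.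
    rewrite -expRM_natr d2 divfK ?gt_eqF//.
    by rewrite -[leRHS]lnK ?posrE ?addr_gt0// ler_expR ltW.
  - by move=> t; rewrite /f indicE; case: (_ \in _); rewrite ?lexx ler01.
have E0 : \sum_(t : n.-tuple _)
    (\prod_(j <- t) (1 / 8 * likelihood_ratio 0 j.1.1 j.1.2)) * f t =
    expect_iid p n f.
  apply: eq_bigr => t _; congr (_ * _); apply: eq_bigr => j _.
  by rewrite /likelihood_ratio oppr0 if_same addr0 mulr1.
move: lev; rewrite E0 -/(expect_iid (fun j => p j * l j) n f) /eta.
lra.
Qed.
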